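(* Let $\alpha$ be a positive real number. Then $\alpha$ is a relation number if and only if the generalized Farey graph $\Gamma_\alpha$ at $\alpha$ is not a tree.
   Context: For $\alpha\in\mathbb{R}$ let $A=\begin{bmatrix}1&1\\0&1\end{bmatrix}$, $B_\alpha=\begin{bmatrix}1&0\\ \alpha&1\end{bmatrix}$, and let $G_\alpha=\langle A,B_\alpha\rangle\subset \mathrm{SL}_2(\mathbb{R})$. The number $\alpha$ is a free number if $G_\alpha$ is isomorphic to the free group of rank $2$; otherwise it is a relation number. The group $G_\alpha$ acts on $S^1=\mathbb{R}\cup\{\infty\}$ by Möbius transformations. Let $\ell=\{0,\infty\}$. The generalized Farey graph $\Gamma_\alpha$ is the simple undirected graph with vertex set $\{g(0),g(\infty): g\in G_\alpha\}\subset\mathbb{R}\cup\{\infty\}$ and edge set $\{g\cdot \ell: g\in G_\alpha\}$, where $g\cdot\ell=\{g(0),g(\infty)\}$ (edges are two-element subsets of the vertex set). A tree is a connected graph without cycles. *)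

(* Defs.v *)
From HB Require Import structures.
From mathcomp Require Import all_boot all_order all_algebra.
From mathcomp Require Import boolp classical_sets functions reals.
From mathcomp Require Import ring.

Set Implicit Arguments.
Unset Strict Implicit.
Unset Printing Implicit Defensive.

Import Order.TTheory GRing.Theory Num.Theory.
Local Open Scope classical_set_scope.
Local Open Scope ring_scope.

Section FreeGroup.
Variable T : choiceType.

(* A letter [(x, false)] stands for the generator [x] and [(x, true)] for its inverse. *)
Local Notation letter := (T * bool)%type.

Definition inv_letter (a : letter) : letter := (a.1, ~~ a.2).

Definition freely_reduced (w : seq letter) : bool :=
  sorted (fun a b => b != inv_letter a) w.

Record free_group : Type := FreeGroup {
  fword :> seq letter;
  fwordP : freely_reduced fword
}.
HB.instance Definition _ := [isSub for fword].
HB.instance Definition _ := [Choice of free_group by <:].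

(* The free reduction of [a :: w] when [w] is freely reduced. *)
Definition push (a : letter) (w : seq letter) : seq letter :=
  if w is b :: w' then if b == inv_letter a then w' else a :: w else [:: a].

Definition word_mul (u v : seq letter) : seq letter := foldr push v u.
Definition word_inv (u : seq letter) : seq letter := rev (map inv_letter u).

Lemma inv_letterK : involutive inv_letter.
Proof. by case=> x b; rewrite /inv_letter /= negbK. Qed.

Lemma push_reduced a w : freely_reduced w -> freely_reduced (push a w).
Proof.
case: w => [//|b w] /= rw; case: eqP => [_|/eqP ne].
  exact: path_sorted rw.
by rewrite /freely_reduced /= ne.
Qed.

Lemma word_mul_reduced u v : freely_reduced v -> freely_reduced (word_mul u v).
Proof. by move=> rv; elim: u => //= a u; apply: push_reduced. Qed.

Lemma word_mulw0 u : freely_reduced u -> word_mul u [::] = u.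
Proof.
elim: u => //= a u IH ru; rewrite IH; last exact: path_sorted ru.
by case: u ru {IH} => //= b u /andP[/negPf ->].
Qed.

Lemma pushK a w : freely_reduced w -> push a (push (inv_letter a) w) = w.
Proof.
case: w => [|b w] /=; first by rewrite eqxx.
rewrite inv_letterK; case: eqVneq => [->|ne _] /=; last by rewrite eqxx.
by case: w => [|c w] //= /andP[/negPf ->].
Qed.

Lemma pushVK a w : freely_reduced w -> push (inv_letter a) (push a w) = w.
Proof. by move=> rw; rewrite -{2}[a]inv_letterK pushK. Qed.

Lemma word_mul_push a u w : freely_reduced w ->
  word_mul (push a u) w = push a (word_mul u w).
Proof.
move=> rw; case: u => [//|b u] /=; case: eqP => [->|//].
by rewrite pushK // word_mul_reduced.
Qed.

Lemma word_mulA u v w : freely_reduced w ->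
  word_mul u (word_mul v w) = word_mul (word_mul u v) w.
Proof. by move=> rw; elim: u => //= a u ->; rewrite word_mul_push. Qed.

Lemma word_mulVw u : freely_reduced u -> word_mul (word_inv u) u = [::].
Proof.
elim: u => // a u IH ru; have ru' : freely_reduced u by exact: path_sorted ru.
rewrite /word_inv /= rev_cons /word_mul -cats1 foldr_cat.
rewrite [X in foldr _ X _](_ : _ = u) ?IH //=; first exact: IH.
by rewrite inv_letterK eqxx.
Qed.

Lemma word_invK : involutive word_inv.
Proof. by move=> u; rewrite /word_inv map_rev revK mapK //; apply: inv_letterK. Qed.

Lemma word_inv_reduced u : freely_reduced u -> freely_reduced (word_inv u).
Proof.
rewrite /freely_reduced /word_inv rev_sorted sorted_map; apply: sub_sorted.
by move=> a b /=; rewrite inv_letterK eq_sym.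
Qed.

Definition free_one : free_group := @FreeGroup [::] isT.
Definition free_mul (u v : free_group) : free_group :=
  FreeGroup (word_mul_reduced u (fwordP v)).
Definition free_inv (u : free_group) : free_group :=
  FreeGroup (word_inv_reduced (fwordP u)).

Lemma free_mulA : associative free_mul.
Proof. by move=> u v w; apply/val_inj/word_mulA/fwordP. Qed.
Lemma free_mul1g : left_id free_one free_mul.
Proof. by move=> u; apply/val_inj. Qed.
Lemma free_mulg1 : right_id free_one free_mul.
Proof. by move=> u; apply/val_inj/word_mulw0/fwordP. Qed.
Lemma free_mulVg : left_inverse free_one free_inv free_mul.
Proof. by move=> u; apply/val_inj/word_mulVw/fwordP. Qed.
Lemma free_mulgV : right_inverse free_one free_inv free_mul.
Proof.
move=> u; rewrite -{1}(_ : free_inv (free_inv u) = u) ?free_mulVg //.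
exact/val_inj/word_invK.
Qed.

HB.instance Definition _ := isGroup.Build free_group
  free_mulA free_mul1g free_mulg1 free_mulVg free_mulgV.

End FreeGroup.

Definition is_subgroup (G : groupType) (H : set G) : Prop :=
  [/\ H 1%g, (forall x y, H x -> H y -> H (x * y)%g)
    & (forall x, H x -> H x^-1%g)].

Definition generated (G : groupType) (S : set G) : set G :=
  smallest (@is_subgroup G) S.

Definition isomorphic_to (F G : groupType) (H : set G) : Prop :=
  exists f : {multiplicative F -> G}, set_bij [set: F] H f.

Section SL2.
Variable R : fieldType.

Definition mx22 (a b c d : R) : 'M[R]_2 :=
  \matrix_(i, j) if i == 0 then (if j == 0 then a else b)
                 else (if j == 0 then c else d).

Record SL2 : Type := MkSL2 {
  SL2_mx :> 'M[R]_2;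
  SL2_det : \det SL2_mx == 1
}.
HB.instance Definition _ := [isSub for SL2_mx].
HB.instance Definition _ := [Choice of SL2 by <:].

Lemma SL2_unitmx (g : SL2) : (g : 'M[R]_2) \in unitmx.
Proof. by rewrite unitmxE (eqP (SL2_det g)) unitr1. Qed.

Lemma SL2_one_subproof : \det (1%:M : 'M[R]_2) == 1.
Proof. by rewrite det1. Qed.
Lemma SL2_mul_subproof (g h : SL2) : \det (g *m h : 'M[R]_2) == 1.
Proof. by rewrite det_mulmx (eqP (SL2_det g)) (eqP (SL2_det h)) mulr1. Qed.
Lemma SL2_inv_subproof (g : SL2) : \det (invmx g) == 1.
Proof. by rewrite det_inv (eqP (SL2_det g)) invr1. Qed.

Definition SL2_one : SL2 := MkSL2 SL2_one_subproof.
Definition SL2_mul (g h : SL2) : SL2 := MkSL2 (SL2_mul_subproof g h).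
Definition SL2_inv (g : SL2) : SL2 := MkSL2 (SL2_inv_subproof g).

Lemma SL2_mulA : associative SL2_mul.
Proof. by move=> f g h; apply/val_inj; rewrite /= mulmxA. Qed.
Lemma SL2_mul1g : left_id SL2_one SL2_mul.
Proof. by move=> g; apply/val_inj; rewrite /= mul1mx. Qed.
Lemma SL2_mulg1 : right_id SL2_one SL2_mul.
Proof. by move=> g; apply/val_inj; rewrite /= mulmx1. Qed.
Lemma SL2_mulVg : left_inverse SL2_one SL2_inv SL2_mul.
Proof. by move=> g; apply/val_inj; rewrite /= mulVmx // SL2_unitmx. Qed.
Lemma SL2_mulgV : right_inverse SL2_one SL2_inv SL2_mul.
Proof. by move=> g; apply/val_inj; rewrite /= mulmxV // SL2_unitmx. Qed.

HB.instance Definition _ := isGroup.Build SL2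
  SL2_mulA SL2_mul1g SL2_mulg1 SL2_mulVg SL2_mulgV.

Lemma det_M2 (M : 'M[R]_2) : \det M = M 0 0 * M 1 1 - M 0 1 * M 1 0.
Proof.
rewrite (expand_det_row _ 0) !big_ord_recl big_ord0 /cofactor !det_mx11 !mxE.
rewrite /= expr0 expr1 mul1r addr0 mulN1r mulrN.
by congr (M _ _ * M _ _ - M _ _ * M _ _); apply/val_inj.
Qed.

Lemma SL2_det_eq (g : SL2) : g 0 0 * g 1 1 - g 0 1 * g 1 0 = 1.
Proof. by rewrite -det_M2; apply/eqP/SL2_det. Qed.

Lemma matA_subproof : \det (mx22 1 1 0 1) == 1.
Proof. by rewrite det_M2 !mxE /=; apply/eqP; ring. Qed.
Lemma matB_subproof (alpha : R) : \det (mx22 1 0 alpha 1) == 1.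
Proof. by rewrite det_M2 !mxE /=; apply/eqP; ring. Qed.

Definition matA : SL2 := MkSL2 matA_subproof.
Definition matB (alpha : R) : SL2 := MkSL2 (matB_subproof alpha).

(* The projective line is [option R], where [None] is the point at infinity. *)
Definition moebius (g : SL2) (z : option R) : option R :=
  match z with
  | Some x => if g 1 0 * x + g 1 1 == 0 then None
              else Some ((g 0 0 * x + g 0 1) / (g 1 0 * x + g 1 1))
  | None => if g 1 0 == 0 then None else Some (g 0 0 / g 1 0)
  end.

Lemma moebius1 z : moebius 1%g z = z.
Proof.
case: z => [x|]; rewrite /moebius !mxE /= ?eqxx //.
by rewrite mul0r add0r oner_eq0 mul1r addr0 divr1.
Qed.

Lemma moebiusM (g h : SL2) z : moebius (g * h)%g z = moebius g (moebius h z).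
Proof.
have Em i j : (g * h)%g i j = g i 0 * h 0 j + g i 1 * h 1 j.
  rewrite /= mxE !big_ord_recl big_ord0 addr0.
  by congr (g _ _ * h _ _ + g _ _ * h _ _); apply/val_inj.
have dg := SL2_det_eq g; have dh := SL2_det_eq h.
have aux (u v : R) : (u, v) <> (0, 0) ->
    let p := h 0 0 * u + h 0 1 * v in let q := h 1 0 * u + h 1 1 * v in
    (if g 1 0 * p + g 1 1 * q == 0 then None
     else Some ((g 0 0 * p + g 0 1 * q) / (g 1 0 * p + g 1 1 * q))) =
    moebius g (if q == 0 then None else Some (p / q)).
  move=> uv0 p q; have [q0|q0] := eqVneq q 0 => /=.
    have p0 : p != 0.
      apply/eqP => p0; apply: uv0; congr pair.
        have -> : u = h 1 1 * p - h 0 1 * q by rewrite -[u]mul1r -dh /p /q; ring.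
        by rewrite p0 q0 !mulr0 subrr.
      have -> : v = h 0 0 * q - h 1 0 * p by rewrite -[v]mul1r -dh /p /q; ring.
      by rewrite p0 q0 !mulr0 subrr.
    rewrite q0 !mulr0 !addr0 mulf_eq0 (negPf p0) orbF.
    by case: eqP => // c0; rewrite -mulf_div divff // mulr1.
  have -> : g 1 0 * (p / q) + g 1 1 = (g 1 0 * p + g 1 1 * q) / q by field.
  have -> : g 0 0 * (p / q) + g 0 1 = (g 0 0 * p + g 0 1 * q) / q by field.
  rewrite mulf_eq0 invr_eq0 (negPf q0) orbF; case: eqP => // /eqP r0.
  by congr Some; rewrite invf_div mulrA mulfVK.
case: z => [x|].
  have /aux /= : (x, 1 : R) <> (0, 0) by move=> [_ e]; have := oner_neq0 R; rewrite e eqxx.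
  rewrite !mulr1 => <-; rewrite /moebius !Em.
  rewrite (_ : _ * x + _ = g 1 0 * (h 0 0 * x + h 0 1)
                         + g 1 1 * (h 1 0 * x + h 1 1)); last by ring.
  by case: ifP => // _; congr (Some (_ / _)); ring.
have /aux /= : (1 : R, 0 : R) <> (0, 0) by move=> [e]; have := oner_neq0 R; rewrite e eqxx.
by rewrite !mulr1 !mulr0 !addr0 => <-; rewrite /moebius !Em.
Qed.

Lemma moebius_0_oo (g : SL2) : moebius g (Some 0) <> moebius g None.
Proof.
have := SL2_det_eq g; rewrite /moebius !mulr0 !add0r.
case: (eqVneq (g 1 1) 0) => [->|d0]; case: (eqVneq (g 1 0) 0) => [->|c0] //.
  by rewrite !mulr0 subrr => /esym/eqP; rewrite oner_eq0.
move=> detg [] /eqP; rewrite eqr_div // => /eqP bc.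
by move: detg; rewrite bc subrr => /esym/eqP; rewrite oner_eq0.
Qed.

End SL2.

Record sgraph (T : choiceType) : Type := SGraph {
  vertices : set T;
  edges : set (set T);
  edgesP : forall e, edges e -> exists x y,
    [/\ x <> y, vertices x, vertices y & e = [set x; y]]
}.

Section Graphs.
Variables (T : choiceType) (X : sgraph T).

Definition adjacent : rel T := fun x y => `[< edges X [set x; y] >].

Definition graph_connected : Prop :=
  forall x y, vertices X x -> vertices X y ->
  exists2 p : seq T, path adjacent x p & last x p = y.

(* Without the bound on the size, an edge xy would count as the cycle x y x. *)
Definition graph_cycle (c : seq T) : Prop := (2 < size c)%N /\ ucycle adjacent c.

Definition is_tree : Prop := graph_connected /\ ~ (exists c, graph_cycle c).

End Graphs.

Section Farey.
Variables (R : realType) (alpha : R).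

Definition Ggroup : set (SL2 R) := generated [set @matA R; matB alpha].

(* [free_group bool] is the free group of rank 2. *)
Definition free_number : Prop := isomorphic_to (free_group bool) Ggroup.

Definition relation_number : Prop := ~ free_number.

Definition ell : set (option R) := [set Some 0; None].

Definition farey_vertices : set (option R) :=
  [set z | exists2 g, Ggroup g & z = moebius g (Some 0) \/ z = moebius g None].

Definition farey_edges : set (set (option R)) :=
  [set e | exists2 g, Ggroup g & e = moebius g @` ell].

Lemma farey_edgesP e : farey_edges e -> exists x y,
  [/\ x <> y, farey_vertices x, farey_vertices y & e = [set x; y]].
Proof.
move=> [g Gg ->]; exists (moebius g (Some 0)), (moebius g None); split.
- exact: moebius_0_oo.
- by exists g => //; left.
- by exists g => //; right.
- by rewrite /ell image_setU !image_set1.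
Qed.

Definition farey_graph : sgraph (option R) := SGraph farey_edgesP.

End Farey.

(* Main.v *)
(** If the graph is a tree then the group is free: a walk spelled by an
    alternating product of nonzero powers of [A] and [B] never backtracks, and
    it closes up when the product is trivial, which would produce a cycle.
    Conversely, free groups of finite rank are Hopfian, so if the group is free
    then [A] and [B] form a basis. An element taking the fixed point of one
    generator to that of another conjugates the former into the centralizer of
    the latter; counting exponents shows that the two generators agree and that
    the element is a power of this generator. Hence a cycle would identify an
    alternating product starting with one generator with a power of the other. *)
From HB Require Import structures.
Require Import Defs.
From mathcomp Require Import all_boot all_order all_algebra all_fingroup.
From mathcomp Require Import boolp classical_sets functions reals.
From mathcomp Require Import ring lra zify.

Set Implicit Arguments.
Unset Strict Implicit.
Unset Printing Implicit Defensive.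

Import Order.TTheory GRing.Theory Num.Theory.
Local Open Scope ring_scope.

(** * Evaluation of words *)

Section Words.
Local Open Scope group_scope.
Variable T : choiceType.
Local Notation letter := (T * bool)%type.
Local Notation F := (free_group T).
Implicit Types (a b : letter) (x : T) (w : seq letter) (u v : F).

Definition eval_letter (G : groupType) (h : T -> G) (a : letter) : G :=
  if a.2 then (h a.1)^-1 else h a.1.

(** Taken on arbitrary words so that inductions can peel off letters; on [F] it is the homomorphism
    extending [h]. *)
Definition eval (G : groupType) (h : T -> G) (w : seq letter) : G :=
  foldr (fun a g => eval_letter h a * g) 1 w.

Definition gen x : F := @FreeGroup T [:: (x, false)] isT.

Lemma eval_letterV (G : groupType) (h : T -> G) a :
  eval_letter h (inv_letter a) = (eval_letter h a)^-1.
Proof. by case: a => x [] /=; rewrite /eval_letter /= ?invgK. Qed.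

Lemma eval_push (G : groupType) (h : T -> G) a w :
  eval h (push a w) = eval_letter h a * eval h w.
Proof.
case: w => [|b w] //=; case: eqP => [->|_] //=.
by rewrite eval_letterV mulVKg.
Qed.

Lemma eval_mul (G : groupType) (h : T -> G) u v :
  eval h (u * v) = eval h u * eval h v.
Proof.
rewrite /= /word_mul; elim: (fword u) => [|a w IH] /=; first by rewrite mul1g.
by rewrite eval_push IH mulgA.
Qed.

Lemma eval1 (G : groupType) (h : T -> G) : eval h (1 : F) = 1.
Proof. by []. Qed.

Lemma evalV (G : groupType) (h : T -> G) u : eval h u^-1 = (eval h u)^-1.
Proof. by apply/esym/mulg1_eq; rewrite -eval_mul mulgV. Qed.

Lemma eval_gen (G : groupType) (h : T -> G) x : eval h (gen x) = h x.
Proof. by rewrite /= mulg1. Qed.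

Lemma eval_eval (G : groupType) (h : T -> G) (k : T -> F) w :
  eval h (eval k w) = eval (fun x => eval h (k x)) w.
Proof.
elim: w => //= a w IH; rewrite eval_mul IH; congr (_ * _).
by rewrite /eval_letter; case: ifP => // _; rewrite evalV.
Qed.

Lemma fword_letter a : fword (eval_letter gen a) = [:: a].
Proof. by case: a => x []. Qed.

Lemma fword_letterM a u : fword (eval_letter gen a * u) = push a u.
Proof. by rewrite [LHS]/= fword_letter. Qed.

Lemma eval_gen_id u : eval gen u = u.
Proof.
apply/val_inj => /=; case: u => w /= rw; elim: w rw => // a w IH raw.
have rw : freely_reduced w by exact: path_sorted raw.
rewrite [eval _ _]/= fword_letterM IH //.
by case: w raw {IH rw} => //= b w /andP[/negPf ->].
Qed.

End Words.

(** * Residual finiteness and the Hopf property *)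

Section ResidualFiniteness.
Local Open Scope group_scope.
Variable T : choiceType.
Local Notation letter := (T * bool)%type.
Local Notation F := (free_group T).
Implicit Types (a b : letter) (x : T) (w : seq letter) (u v : F).

(** One pair is added at a time: following [s] by the transposition of [s a] and [b] sends [a] to
    [b] and moves none of the earlier targets. *)
Lemma perm_extending_pairs (I : finType) (ps : seq (I * I)) :
  uniq (unzip1 ps) -> uniq (unzip2 ps) ->
  exists s : {perm I}, {in ps, forall p, s p.1 = p.2}.
Proof.
elim: ps => [|[a b] ps IH] /=; first by exists 1.
move=> /andP[na u1] /andP[nb u2]; have [s sP] := IH u1 u2.
exists (s * tperm (s a) b) => p; rewrite inE permM => /predU1P[->|pps] /=.
  exact: tpermL.
rewrite (sP _ pps) tpermD //; last first.
  by apply: contraNneq nb => ->; exact: map_f.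
rewrite -(sP _ pps) (inj_eq perm_inj); apply: contraNneq na => ->.
exact: map_f.
Qed.

(* The letters [x^-1] of [w] contribute reversed arrows; a collision of two
   sources or two targets is exactly a cancellation in [w]. *)
Definition step_arrows x w : seq ('I_(size w).+1 * 'I_(size w).+1) :=
  [seq if (nth (x, false) w i).2 then (inord i.+1, inord i) else (inord i, inord i.+1)
  | i <- iota 0 (size w) & (nth (x, false) w i).1 == x].

Lemma reduced_nth x w i : freely_reduced w -> (i.+1 < size w)%N ->
  nth (x, false) w i.+1 != inv_letter (nth (x, false) w i).
Proof.
elim: w i => // a w IH [|i] /= rw.
  by case: w rw {IH} => //= b w /andP[].
by rewrite ltnS => iw; apply: IH => //; exact: path_sorted rw.
Qed.

Lemma step_arrows_uniq x w : freely_reduced w ->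
  uniq (unzip1 (step_arrows x w)) /\ uniq (unzip2 (step_arrows x w)).
Proof.
move=> rw; pose l i := nth (x, false) w i.
have no i : (i.+1 < size w)%N -> (l i).1 == x -> (l i.+1).1 == x ->
    (l i).2 = (l i.+1).2.
  move=> iw /eqP xi /eqP xi1; move: (reduced_nth x rw iw); rewrite -/(l i) -/(l i.+1).
  move: xi xi1; case: (l i) (l i.+1) => [y []] [z []] //= -> ->; by rewrite eqxx.
split; rewrite /unzip1 /unzip2 /step_arrows -map_comp map_inj_in_uniq
    ?filter_uniq ?iota_uniq // => i j;
  rewrite !mem_filter !mem_iota !add0n => /andP[xi iw] /andP[xj jw];
  have ni := no i; have nj := no j; move: xi xj ni nj;
  rewrite /= -/(l i) -/(l j).
all: case Ei: (l i).2; case Ej: (l j).2 => xi xj /= ni nj /(congr1 val);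
  rewrite /= !inordK ?ltnS //; try lia.
(* What remains are neighbouring positions carrying opposite signs, which [no] excludes. *)
all: by move=> e; subst; first [move: Ej; rewrite -(ni jw xi xj)
                               | move: Ei; rewrite -(nj iw xj xi)].
Qed.

(** Each generator permutes the positions of the word by some extension of its arrows. Reading the
    word then carries position 0 step by step to the last position, so a nonempty word acts
    nontrivially. *)
Lemma free_group_residually_finite u : u != 1 ->
  exists n (h : T -> {perm 'I_n.+1}), eval h u != 1.
Proof.
move=> u1; set w := fword u; exists (size w).
have /boolp.choice[h hP] : forall x, exists s : {perm 'I_(size w).+1},
    {in step_arrows x w, forall p, s p.1 = p.2}.
  by move=> x; have [u1' u2] := step_arrows_uniq x (fwordP u);
     exact: perm_extending_pairs.
exists h.
have step k i : (i + k = size w)%N ->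
    eval h (drop i w) (inord i : 'I_(size w).+1) = ord_max.
  elim: k i => [|k IH] i ik.
    rewrite drop_oversize ?perm1; last by rewrite -ik addn0.
    by apply/val_inj; rewrite /= inordK -ik addn0.
  have iw : (i < size w)%N by lia.
  case Ed: (drop i w) => [|[x e] w'].
    by move/(congr1 size): Ed; rewrite size_drop /=; lia.
  have nx : nth (x, false) w i = (x, e) by rewrite -[i]addn0 -nth_drop Ed.
  have -> : w' = drop i.+1 w by rewrite -add1n -drop_drop Ed /= drop0.
  rewrite [eval _ _]/= permM -[RHS](IH i.+1) ?addSnnS //; congr (fun_of_perm _ _).
  have : (if e then (inord i.+1, inord i) else (inord i, inord i.+1))
      \in step_arrows x w.
    apply/mapP; exists i; last by rewrite nx.
    by rewrite mem_filter nx eqxx mem_iota.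
  by rewrite /eval_letter /=; case: (e) => /hP /= hx; rewrite -?{1}hx ?permK.
apply/eqP => /(congr1 (fun s : {perm _} => s (inord 0))).
have := step (size w) 0 (add0n _); rewrite drop0 => ->.
rewrite perm1 => /(congr1 val); rewrite /= inordK // => /size0nil w0.
by case/eqP: u1; apply/val_inj.
Qed.

End ResidualFiniteness.

Section Hopf.
Local Open Scope group_scope.

(* Malcev: precomposition with the endomorphism [k] acts injectively on the
   finite set of homomorphisms to a finite group, hence also surjectively. *)
Lemma free_group_hopfian (I : finType) (k : I -> free_group I) :
  (forall u : free_group I, exists v : free_group I, u = eval k v) ->
  forall u : free_group I, eval k u = 1 -> u = 1.
Proof.
move=> ksurj u ku1; apply/eqP/negPn/negP => /free_group_residually_finite.
case=> n [h /eqP]; apply.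
pose Phi (f : {ffun I -> {perm 'I_n.+1}}) := [ffun i => eval f (k i)].
have PhiE f (v : free_group I) : eval (Phi f) v = eval f (eval k v).
  by rewrite eval_eval; congr eval; apply/funext => i; rewrite ffunE.
have Phi_inj : injective Phi.
  move=> f g fg; apply/ffunP => i; have [v giv] := ksurj (gen i).
  by rewrite -(eval_gen f) -(eval_gen g) giv -!PhiE fg.
(* By finiteness [h] itself is a composite with [eval k], so it kills [u]. *)
have /codomP[f hf] := injF_onto Phi_inj [ffun i => h i].
have -> : h = Phi f by rewrite -hf; apply/funext => i; rewrite ffunE.
by rewrite PhiE ku1.
Qed.
End Hopf.

(** * Powers, centralizers and alternating products *)

Section IntegerPowers.
Local Open Scope group_scope.
Implicit Types (G : groupType) (k : int).

Definition expgz G (g : G) k : G :=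
  match k with Posz n => g ^+ n | Negz n => g ^- n.+1 end.

Lemma expgz_succ G (g : G) k : expgz g (k + 1)%R = g * expgz g k.
Proof.
case: k => [n|[|n]].
- by rewrite -PoszD addn1 /= expgS.
- by rewrite NegzE addrC subrr /= mulgV.
have -> : (Negz n.+1 + 1 = Negz n)%R by lia.
by rewrite /= (expgSr _ n.+1) invgM mulVKg.
Qed.

Lemma expgz_pred G (g : G) k : expgz g (k - 1)%R = g^-1 * expgz g k.
Proof. by rewrite -{2}[k](subrK 1%R) expgz_succ mulKg. Qed.

Lemma expgz_ind (P : int -> Prop) : P 0%R ->
  (forall k, P k -> P (k + 1)%R) -> (forall k, P k -> P (k - 1)%R) -> forall k, P k.
Proof.
move=> P0 PS PP; elim=> [//|n IH|n IH].
  by rewrite -addn1 PoszD; exact: PS.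
by rewrite -addn1 PoszD opprD; exact: PP.
Qed.

Lemma eval_expgz (T : choiceType) G (h : T -> G) (u : free_group T) k :
  eval h (expgz u k) = expgz (eval h u) k.
Proof.
elim/expgz_ind: k => [//|k IH|k IH]; first by rewrite !expgz_succ eval_mul IH.
by rewrite !expgz_pred eval_mul evalV IH.
Qed.

End IntegerPowers.

(** * Exponent sums and centralizers of generators *)

Section FreeGroupTheory.
Local Open Scope group_scope.
Variable T : choiceType.
Local Notation letter := (T * bool)%type.
Local Notation F := (free_group T).
Implicit Types (a b : letter) (x y : T) (w : seq letter) (u v : F) (k : int).

(** The coordinate at [x] of the abelianization, computed on words. *)
Definition exponent_sum x w : int :=
  (\sum_(a <- w | a.1 == x) (if a.2 then -1 else 1))%R.

Lemma exponent_sum_push x a w :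
  exponent_sum x (push a w) = (exponent_sum x [:: a] + exponent_sum x w)%R.
Proof.
rewrite /exponent_sum; case: w => [|b w] /=; first by rewrite big_nil addr0.
case: eqP => [->|_]; rewrite !big_cons big_nil /=; last first.
  by case: ifP => _; rewrite ?addr0 ?add0r.
by case: a => y [] /=; case: ifP => _;
  rewrite ?addr0 ?add0r // addrA ?subrr ?addNr add0r.
Qed.

Lemma exponent_sumM x u v :
  exponent_sum x (u * v) = (exponent_sum x u + exponent_sum x v)%R.
Proof.
rewrite /= /word_mul; elim: (fword u) => [|a w IH] /=.
  by rewrite {2}/exponent_sum big_nil add0r.
rewrite exponent_sum_push IH addrA /exponent_sum !big_cons !big_nil.
by case: ifP; rewrite ?addr0 ?add0r.
Qed.

Lemma exponent_sum1 x : exponent_sum x (1 : F) = 0%R.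
Proof. by rewrite /exponent_sum big_nil. Qed.

Lemma exponent_sumV x u : exponent_sum x u^-1 = (- exponent_sum x u)%R.
Proof.
by apply/eqP; rewrite -addr_eq0 -exponent_sumM mulVg exponent_sum1.
Qed.

Lemma exponent_sum_expgz x u k :
  exponent_sum x (expgz u k) = (exponent_sum x u * k)%R.
Proof.
elim/expgz_ind: k => [|k IH|k IH]; first by rewrite mulr0 exponent_sum1.
  by rewrite expgz_succ exponent_sumM IH; ring.
by rewrite expgz_pred exponent_sumM exponent_sumV IH; ring.
Qed.

Lemma exponent_sum_gen x y : exponent_sum x (gen y) = ((y == x)%:R)%R.
Proof. by rewrite /exponent_sum big_cons big_nil /=; case: eqP. Qed.

Lemma size_push a w : (size (push a w) <= (size w).+1)%N.
Proof. by case: w => //= b w; case: ifP => _ /=; lia. Qed.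

Lemma size_word_mul w w' : (size (word_mul w w') <= size w + size w')%N.
Proof. by elim: w => //= a w IH; apply: leq_trans (size_push _ _) _. Qed.

(** Each cancellation loses two letters, so a product of full length is a plain concatenation. *)
Lemma word_mul_cat w w' :
  size (word_mul w w') = (size w + size w')%N -> word_mul w w' = w ++ w'.
Proof.
elim: w => //= a w IH sz.
have := size_push a (word_mul w w'); have := size_word_mul w w'.
rewrite sz addSn ltnS => le1 le2.
have e : size (word_mul w w') = (size w + size w')%N.
  by apply/eqP; rewrite eqn_leq le1 le2.
move: sz; rewrite -(IH e) addSn -e.
by case: (word_mul w w') => //= b t; case: ifP => //= _; lia.
Qed.

Lemma push_free a w : (forall b w', w = b :: w' -> b.1 != a.1) -> push a w = a :: w.
Proof.
case: w => //= b w /(_ b w erefl) ba; case: eqP => // e.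
by rewrite e eqxx in ba.
Qed.

Lemma fword_cons a w (r : freely_reduced (a :: w)) (r' : freely_reduced w) :
  FreeGroup r = eval_letter (@gen T) a * FreeGroup r'.
Proof.
apply/val_inj; rewrite /= fword_letter /=.
by case: w r {r'} => //= b w /andP[/negPf ->].
Qed.

(** Induction on the word. A first letter over [x] commutes with [gen x] and can be stripped. With
    any other first letter, multiplying by [x] on the left cancels nothing, so by length nothing
    cancels on the right either, and the first letters of the two products disagree. *)
Lemma centralizer_gen x u : commute (gen x) u -> exists k, u = expgz (gen x) k.
Proof.
case: u => w; elim: w => [|a w IH] r cu; first by exists 0%R; exact/val_inj.
have r' : freely_reduced w by exact: path_sorted r.
have [ax|ax] := eqVneq a.1 x.
  have ca : commute (gen x) (eval_letter (@gen T) a).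
    rewrite /eval_letter ax; case: ifP => _ //; exact/commuteV.
  have [|k ek] := IH r'.
    rewrite -[FreeGroup r'](mulKg (eval_letter (@gen T) a)) -(fword_cons r).
    by apply: commuteM => //; exact: commuteV.
  rewrite (fword_cons _ r') ek /eval_letter ax; case: ifP => _.
    by exists (k - 1)%R; rewrite expgz_pred.
  by exists (k + 1)%R; rewrite expgz_succ.
have e : push (x, false) (a :: w) = word_mul (a :: w) [:: (x, false)].
  exact: (congr1 (@fword T) cu).
rewrite push_free in e; last by move=> b w' [<- _].
move: (e); rewrite word_mul_cat; last by rewrite -e /= addn1.
by move=> [e1 _]; rewrite -e1 eqxx in ax.
Qed.

End FreeGroupTheory.

(** * Alternating products of powers *)

Section Syllables.
Local Open Scope group_scope.
Local Notation F := (free_group bool).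

(** With nonzero exponents this is the normal form in the free product of two infinite cyclic
    groups; [b] is the generator of the first syllable. *)
Fixpoint syll (G : groupType) (h : bool -> G) (b : bool) (s : seq int) : G :=
  if s is k :: s' then expgz (h b) k * syll h (~~ b) s' else 1.

Lemma eval_syll (G : groupType) (h : bool -> G) b s :
  eval h (syll (@gen bool) b s) = syll h b s.
Proof.
elim: s b => //= k s IH b.
by rewrite eval_mul IH eval_expgz eval_gen.
Qed.

Lemma syllP (u : F) : exists b s, u = syll (@gen bool) b s /\ (0%R : int) \notin s.
Proof.
rewrite -(eval_gen_id u); elim: (fword u) => [|[x e] w [b [s [es ns]]]] /=.
  by exists true, [::].
rewrite {}es; pose k : int := if e then (- 1)%R else 1%R.
have kE j : eval_letter (@gen bool) (x, e) * expgz (gen x) j = expgz (gen x) (k + j)%R.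
  rewrite addrC /k /eval_letter /=; case: (e); first by rewrite expgz_pred.
  by rewrite expgz_succ.
have k1 : eval_letter (@gen bool) (x, e) = expgz (gen x) k.
  by rewrite -[k]addr0 -kE mulg1.
have k0 : 0%R != k by rewrite /k; case: (e).
case: s ns => [|j s] ns.
  by exists x, [:: k]; rewrite /= k1 mem_seq1 k0.
have [xb|xb] := eqVneq x b; last first.
  exists x, (k :: j :: s); rewrite inE negb_or k0 ns [syll _ x _]/= k1.
  by split=> //; move: xb; case: (x) (b) => [] [].
subst b; rewrite [syll _ _ _]/= mulgA kE.
move: ns; rewrite inE negb_or => /andP[_ ns].
(* If the merged exponent vanishes the syllable disappears and the product starts with the other
   generator. *)
have [->|kj] := eqVneq (k + j)%R 0%R; first by exists (~~ x), s; rewrite mul1g.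
by exists x, (k + j :: s)%R; rewrite inE negb_or eq_sym kj.
Qed.

Definition starts_with (b : bool) (u : F) : bool :=
  if fword u is a :: _ then a.1 == b else false.

Lemma starts_with_expgzM b k (u : F) : k != 0%R -> ~~ starts_with b u ->
  starts_with b (expgz (gen b) k * u).
Proof.
move=> k0 nu.
have main e n : exists w,
    fword (eval_letter (@gen bool) (b, e) ^+ n.+1 * u) = (b, e) :: w.
  elim: n => [|n [w IH]].
    exists (fword u); rewrite expg1 fword_letterM push_free //.
    by move=> c w' ew; move: nu; rewrite /starts_with ew.
  exists ((b, e) :: w); rewrite expgS -mulgA fword_letterM IH /=.
  by rewrite xpair_eqE eqxx; case: (e).
case: k k0 => [[|m]|m] //= _.
  by have [w ew] := main false m; rewrite /starts_with ew /=.
have [w] := main true m; rewrite [eval_letter _ _]/= expVgn => ew.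
by rewrite /starts_with ew /=.
Qed.

Lemma starts_with_other b u : starts_with b u -> ~~ starts_with (~~ b) u.
Proof. by rewrite /starts_with; case: (fword u) => //= a _ /eqP->; case: b. Qed.

Lemma starts_with_syll b s : (0%R : int) \notin s ->
  starts_with b (syll (@gen bool) b s) = (s != [::]).
Proof.
elim: s b => // k s IH b; rewrite inE negb_or eq_sym => /andP[k0 ns].
apply: starts_with_expgzM => //; have := IH (~~ b) ns.
have [->//|_ /= /starts_with_other] := eqVneq s [::].
by rewrite negbK.
Qed.

End Syllables.

(** * Walks in graphs *)

Section Walks.
Variables (T : choiceType) (e : rel T).

Fixpoint nonbacktracking (s : seq T) : bool :=
  if s is x :: ((y :: z :: _) as s') then (x != z) && nonbacktracking s' else true.

Lemma nonbacktracking_behead x s : nonbacktracking (x :: s) -> nonbacktracking s.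
Proof. by case: s => [|y [|z s]] //= /andP[]. Qed.

Lemma uniq_nonbacktracking (s : seq T) : uniq s -> nonbacktracking s.
Proof.
elim: s => // x [|y [|z s]] // IH /andP[xs us]; apply/andP; split; last exact: IH.
by apply: contraNneq xs => ->; rewrite !inE eqxx orbT.
Qed.

(* A shortest closed subwalk of a repeating walk is a cycle: it has length
   neither 1 (no loops) nor 2 (no backtracking). *)
Lemma nonbacktracking_cycle (s : seq T) : irreflexive e ->
  sorted e s -> nonbacktracking s -> ~~ uniq s ->
  exists c, (2 < size c)%N /\ ucycle e c.
Proof.
move=> irr; elim: s => // x s IH es nb.
have [us|nus _] := boolP (uniq s); last first.
  by apply: IH nus; [exact: path_sorted es|exact: nonbacktracking_behead nb].
(* Now [x] is the only repeated vertex. It returns after [j.+1] steps, so the closed walk has [j.+1]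
   vertices and [j] must be at least 2. *)
rewrite /= us andbT negbK => xs; pose j := index x s.
have js : (j < size s)%N by rewrite index_mem.
have j2 : (1 < j)%N.
  rewrite /j; case: s es nb xs {us js j IH} => [//|y [|z s]] /= /andP[exy _] nb.
    by rewrite inE => /eqP exy'; rewrite exy' irr in exy.
  have -> : (y == x) = false by apply/eqP => yx; rewrite yx irr in exy.
  by case/andP: nb => xz _; rewrite eq_sym (negPf xz).
exists (x :: take j s); split; first by rewrite /= size_take js; lia.
rewrite /ucycle /= take_uniq // andbT; apply/andP; split.
  have e1 : take j.+1 s = rcons (take j s) x by rewrite (take_nth x js) nth_index.
  by rewrite -e1; exact: take_path.
by apply/negP => /index_ltn; rewrite -/j ltnn.
Qed.

Definition joined (x y : T) : Prop := exists2 p, path e x p & last x p = y.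

Lemma joined_refl x : joined x x. Proof. by exists [::]. Qed.

Lemma joined_edge x y : e x y -> joined x y.
Proof. by move=> exy; exists [:: y] => //=; rewrite exy. Qed.

Lemma joined_trans y x z : joined x y -> joined y z -> joined x z.
Proof.
move=> [p pp <-] [q pq <-]; exists (p ++ q); first by rewrite cat_path pp.
by rewrite last_cat.
Qed.

Lemma joined_sym x y : symmetric e -> joined x y -> joined y x.
Proof.
move=> es [p pp <-]; exists (rev (belast x p)).
  by rewrite rev_path (@eq_path _ _ e) // => u v; rewrite es.
by case: p pp => //= y' p _; rewrite rev_cons last_rcons.
Qed.

Lemma joined_map (f : T -> T) x y : {homo f : u v / e u v} ->
  joined x y -> joined (f x) (f y).
Proof.
move=> fe [p pp <-]; exists (map f p); last by rewrite last_map.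
exact: homo_path pp.
Qed.

End Walks.

(** * The action on the Farey graph *)

Section SL2Facts.
Variable R : fieldType.
Implicit Types g h : SL2 R.

Lemma SL2_eq g h : g 0 0 = h 0 0 -> g 0 1 = h 0 1 -> g 1 0 = h 1 0 -> g 1 1 = h 1 1 ->
  g = h.
Proof.
move=> e00 e01 e10 e11; apply/val_inj/matrixP => i j.
have two (k : 'I_2) : k = 0 \/ k = 1.
  by case: k => -[|[|//]] ?; [left|right]; apply/val_inj.
by case: (two i) => ->; case: (two j) => ->.
Qed.

Lemma SL2_mulE g h i j : (g * h)%g i j = g i 0 * h 0 j + g i 1 * h 1 j.
Proof.
rewrite /= mxE !big_ord_recl big_ord0 addr0.
by congr (g _ _ * h _ _ + g _ _ * h _ _); apply/val_inj.
Qed.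

Lemma SL2_oneE i j : (1%g : SL2 R) i j = (i == j)%:R.
Proof. by rewrite /= mxE. Qed.

Lemma SL2_adj_subproof g : \det (mx22 (g 1 1) (- g 0 1) (- g 1 0) (g 0 0)) == 1.
Proof. by rewrite det_M2 !mxE /= mulrNN -(SL2_det_eq g); apply/eqP; ring. Qed.

Lemma SL2_invE g : g^-1%g = MkSL2 (SL2_adj_subproof g).
Proof.
apply: mulg1_eq; have dg := SL2_det_eq g.
by apply: SL2_eq; rewrite SL2_mulE SL2_oneE !mxE /= -?dg; ring.
Qed.

(** The second column determines the image of 0; for powers of [matB] the first column determines
    the image of infinity. *)
Lemma matA_expgz (k : int) :
  expgz (@matA R) k 0 1 = k%:~R /\ expgz (@matA R) k 1 1 = 1.
Proof.
elim/expgz_ind: k => [|k [IH0 IH1]|k [IH0 IH1]]; first by rewrite !SL2_oneE.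
  by rewrite expgz_succ !SL2_mulE IH0 IH1 !mxE /= intrD; split; ring.
by rewrite expgz_pred !SL2_mulE IH0 IH1 SL2_invE !mxE /= !mxE /= intrB; split; ring.
Qed.

Lemma matB_expgz (alpha : R) (k : int) :
  expgz (matB alpha) k 0 0 = 1 /\ expgz (matB alpha) k 1 0 = alpha * k%:~R.
Proof.
elim/expgz_ind: k => [|k [IH0 IH1]|k [IH0 IH1]].
- by rewrite !SL2_oneE mulr0.
- by rewrite expgz_succ !SL2_mulE IH0 IH1 !mxE /= intrD; split; ring.
by rewrite expgz_pred !SL2_mulE IH0 IH1 SL2_invE !mxE /= !mxE /= intrB; split; ring.
Qed.

End SL2Facts.

Section FareyGraph.
Variables (R : realType) (alpha : R).
Local Notation F := (free_group bool).
Implicit Types (g : SL2 R) (b c : bool) (u v : F).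

Definition pgen b : SL2 R := if b then matB alpha else @matA R.

(** Indexed so that [cusp b] is the fixed point of [pgen b]; the two cusps are the ends of [ell]. *)
Definition cusp b : option R := if b then Some 0 else None.

Local Notation rep := (eval pgen).

Lemma GgroupP g : Ggroup alpha g <-> exists u, g = rep u.
Proof.
split=> [Gg|[u ->]]; last first.
  move=> H [[H1 HM HV] sub].
  have Hgen b : H (pgen b) by apply: sub; case: b; [right|left].
  elim: (fword u) => //= a w; apply: HM.
  by rewrite /eval_letter; case: ifP => _ //; apply: HV.
apply: (smallest_sub (X := [set g | exists u, g = rep u]%classic) _ _ Gg)
  => [|h [->|->]].
- split; first by exists 1%g.
    by move=> x y [u ->] [v ->]; exists (u * v)%g; rewrite eval_mul.
  by move=> x [u ->]; exists u^-1%g; rewrite evalV.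
- by exists (gen false); rewrite eval_gen.
- by exists (gen true); rewrite eval_gen.
Qed.

Lemma pgen_cusp b : moebius (pgen b) (cusp b) = cusp b.
Proof.
case: b; rewrite /moebius /= !mxE /= ?eqxx //.
by rewrite mulr0 add0r oner_eq0 mulr0 add0r mul0r.
Qed.

Lemma moebiusK g z : moebius g^-1%g (moebius g z) = z.
Proof. by rewrite -moebiusM mulVg moebius1. Qed.

Lemma pgen_expgz_cusp b k : moebius (expgz (pgen b) k) (cusp b) = cusp b.
Proof.
elim/expgz_ind: k => [|k IH|k IH]; first by rewrite moebius1.
  by rewrite expgz_succ moebiusM IH pgen_cusp.
by rewrite expgz_pred moebiusM IH -{1}(pgen_cusp b) moebiusK.
Qed.

(** The [k]-th power of [matA] sends 0 to [k], that of [matB] sends infinity to $1/(\alpha k)$. This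
    is what prevents walks from backtracking. *)
Lemma pgen_expgz_other b k : alpha != 0 -> k != 0 ->
  moebius (expgz (pgen b) k) (cusp (~~ b)) != cusp (~~ b).
Proof.
move=> a0 k0; have kR : k%:~R != 0 :> R by rewrite intr_eq0.
case: b; rewrite /moebius /=.
  have [-> ->] := matB_expgz alpha k.
  by rewrite mulf_eq0 (negPf a0) (negPf kR).
have [-> ->] := matA_expgz R k.
by rewrite !mulr0 !add0r oner_eq0 divr1; apply: contraNneq kR => -[->].
Qed.

Lemma moebius_inj g : injective (moebius g).
Proof. exact: can_inj (moebiusK g). Qed.

Lemma moebius_cusp_neq g b : moebius g (cusp b) != moebius g (cusp (~~ b)).
Proof. by rewrite (inj_eq (@moebius_inj g)); case: b. Qed.

(* The conjugate of a unipotent fixing [cusp c] is unipotent fixing [cusp b];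
   the unipotents fixing a given point commute. *)
Lemma commute_conj_pgen g b c : moebius g (cusp c) = cusp b ->
  commute (pgen b) (g * pgen c * g^-1)%g.
Proof.
rewrite SL2_invE /commute => gcb; have dg := SL2_det_eq g.
(* In homogeneous coordinates the image of [cusp c] is a column of [g]; its being [cusp b] makes one
   entry of that column vanish. *)
have gz : (if c then g (if b then 0 else 1) 1 else g (if b then 0 else 1) 0) = 0.
  move: gcb dg; case: b; case: c; rewrite /moebius /=.
  - rewrite !mulr0 !add0r; case: ifP => // /negbT d0 [] /eqP.
    by rewrite mulf_eq0 invr_eq0 (negPf d0) orbF => /eqP.
  - case: ifP => // /negbT d0 [] /eqP.
    by rewrite mulf_eq0 invr_eq0 (negPf d0) orbF => /eqP.
  - by rewrite !mulr0 !add0r; case: ifP => // /eqP.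
  - by case: ifP => // /eqP.
move: gz {gcb}; case: b; case: c => gz; apply: SL2_eq;
  rewrite !SL2_mulE ?mxE /= ?mxE /= ?gz; rewrite gz in dg; nra.
Qed.

(** The boolean [c] records the direction in which the translate of [ell] is traversed. *)
Lemma adjacentP x y : adjacent (farey_graph alpha) x y <->
  exists u c, x = moebius (rep u) (cusp c) /\ y = moebius (rep u) (cusp (~~ c)).
Proof.
split=> [/asboolP /= [g /GgroupP[u ->]]|[u [c [-> ->]]]]; last first.
  apply/asboolP; exists (rep u); first by apply/GgroupP; exists u.
  rewrite /ell image_setU !image_set1; case: c => //=.
  by rewrite setUC.
rewrite /ell image_setU !image_set1 => e.
have neq := @moebius_0_oo _ (rep u).
have [xe ye] : ([set x; y] x /\ [set x; y] y)%classic by split; [left|right].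
have [ze ie] : ([set x; y] (moebius (rep u) (Some 0)) /\
    [set x; y] (moebius (rep u) None))%classic by rewrite e; split; [left|right].
rewrite e in xe ye; exists u.
case: xe => ex; [exists true|exists false]; split; try exact: ex.
  by case: ie => [ie|/esym //]; case: neq; exact: etrans (esym ex) (esym ie).
by case: ze => [ze|/esym //]; case: neq; exact: etrans ze ex.
Qed.

Local Notation adj := (adjacent (farey_graph alpha)).

Lemma adj_sym : symmetric adj.
Proof. by move=> x y; rewrite /adjacent setUC. Qed.

Lemma adj_irr : irreflexive adj.
Proof.
move=> x; apply/negP => /adjacentP[u [c [ex ey]]].
by have := moebius_cusp_neq (rep u) c; rewrite -ex -ey eqxx.
Qed.

Lemma adj_moebius v x y : adj x y -> adj (moebius (rep v) x) (moebius (rep v) y).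
Proof.
move=> /adjacentP[u [c [-> ->]]]; apply/adjacentP; exists (v * u)%g, c.
by rewrite eval_mul !moebiusM.
Qed.

Lemma adj_cusps v b : adj (moebius (rep v) (cusp b)) (moebius (rep v) (cusp (~~ b))).
Proof. by apply/adjacentP; exists v, b. Qed.

Lemma joined_cusps b c : joined adj (cusp b) (cusp c).
Proof.
have [->|bc] := eqVneq b c; first exact: joined_refl.
have -> : c = ~~ b by case: b c bc => [] [].
by apply: joined_edge; have := adj_cusps 1%g b; rewrite eval1 !moebius1.
Qed.

(** Induction on the word: its first letter [a] fixes [cusp a.1], so a walk from infinity to that
    cusp can be followed by the translate under [a] of a walk from the cusp through infinity to the
    target of the shorter word. *)
Lemma farey_connected : graph_connected (farey_graph alpha).
Proof.
suff main u c : joined adj None (moebius (rep u) (cusp c)).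
  have vert z : vertices (farey_graph alpha) z -> joined adj None z.
    by case=> g /GgroupP[u ->] [->|->]; [exact: (main u true)|exact: (main u false)].
  move=> x y /vert nx /vert ny; apply: joined_trans ny.
  by apply: joined_sym => //; exact: adj_sym.
elim: (fword u) => [|a w IH] /=; first by rewrite moebius1; exact: (joined_cusps false).
pose la := eval_letter (@gen bool) a.
have ela : eval_letter pgen a = rep la.
  by rewrite /la /eval_letter; case: ifP => _; rewrite ?evalV eval_gen.
rewrite moebiusM ela; apply: joined_trans (joined_cusps false a.1) _.
have {1}<- : moebius (rep la) (cusp a.1) = cusp a.1.
  rewrite -ela /eval_letter; case: ifP => _; rewrite ?pgen_cusp //.
  by rewrite -{1}(pgen_cusp a.1) moebiusK.
apply: joined_map; first by move=> x y; exact: adj_moebius.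
exact: joined_trans (joined_cusps a.1 false) IH.
Qed.

(** * Acyclic graphs give free groups *)

Section Acyclic.
Hypothesis alpha_neq0 : alpha != 0.

(** Successive edges are translates of [ell] pivoting about a common end: the power of [pgen b]
    fixes [cusp b], so the edges of [g] and of [g * expgz (pgen b) k] share the vertex
    [moebius g (cusp b)]. *)
Fixpoint syll_walk g b (s : seq int) : seq (option R) :=
  moebius g (cusp (~~ b)) ::
  if s is k :: s' then syll_walk (g * expgz (pgen b) k)%g (~~ b) s'
  else [:: moebius g (cusp b)].

Lemma syll_walk_cons g b s : exists t, syll_walk g b s =
  [:: moebius g (cusp (~~ b)), moebius g (cusp b) & t] /\ size t = size s.
Proof.
elim: s g b => [|k s IH] g b /=; first by exists [::].
have [t [-> st]] := IH (g * expgz (pgen b) k)%g (~~ b).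
rewrite negbK moebiusM pgen_expgz_cusp.
by eexists; split; first reflexivity; rewrite /= st.
Qed.

Lemma last_syll_walk x g b s : exists c,
  last x (syll_walk g b s) = moebius (g * syll pgen b s)%g (cusp c).
Proof.
elim: s x g b => [|k s IH] x g b /=; first by exists b; rewrite mulg1.
by have [c ->] := IH (moebius g (cusp (~~ b))) (g * expgz (pgen b) k)%g (~~ b);
   exists c; rewrite mulgA.
Qed.

Lemma syll_walk_path u b s : sorted adj (syll_walk (rep u) b s).
Proof.
elim: s u b => [|k s IH] u b /=.
  by rewrite andbT -{2}[b]negbK; exact: adj_cusps.
have := IH (u * expgz (gen b) k)%g (~~ b).
rewrite eval_mul eval_expgz eval_gen.
have [t [-> _]] := syll_walk_cons (rep u * expgz (pgen b) k)%g (~~ b) s.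
rewrite negbK moebiusM pgen_expgz_cusp /= => ->; rewrite andbT.
by rewrite -{2}[b]negbK; exact: adj_cusps.
Qed.

Lemma syll_walk_nonbacktracking g b s : 0 \notin s ->
  nonbacktracking (syll_walk g b s).
Proof.
elim: s g b => // k s IH g b; rewrite inE negb_or eq_sym => /andP[k0 ns].
have := IH (g * expgz (pgen b) k)%g (~~ b) ns.
have [t [e _]] := syll_walk_cons (g * expgz (pgen b) k)%g (~~ b) s.
rewrite [syll_walk g b _]/= e => nb; apply/andP; split; last exact: nb.
rewrite moebiusM (inj_eq (@moebius_inj g)) eq_sym.
exact: pgen_expgz_other.
Qed.

(** When the product is trivial the walk ends at a cusp, and both cusps are already its first two
    vertices; the repetition yields a cycle. *)
Lemma acyclic_syll b (s : seq int) : ~ (exists p, graph_cycle (farey_graph alpha) p) ->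
  0 \notin s -> syll pgen b s = 1%g -> s = [::].
Proof.
move=> nocyc ns s1; apply/eqP/negPn/negP => s0; apply: nocyc.
have walk := syll_walk_path 1%g b s; rewrite eval1 in walk.
have nb := syll_walk_nonbacktracking 1%g b ns.
apply: (nonbacktracking_cycle adj_irr walk nb).
have [c] := last_syll_walk None 1%g b s; rewrite mul1g s1.
(* A nonempty [s] supplies a third vertex, so the endpoint lies beyond the initial edge. *)
have [[|z t] [-> st]] := syll_walk_cons 1%g b s; first by case: s st s0 {walk nb ns s1}.
rewrite !moebius1 /= => lc; apply/negP => /and3P[].
have lin : cusp c \in z :: t by rewrite -lc mem_last.
rewrite inE negb_or => /andP[_ /negP n1] /negP n2 _.
have [cb|cb] := eqVneq c b; first by apply: n2; rewrite -cb.
by apply: n1; rewrite (_ : ~~ b = c) //; case: (b) (c) cb => [] [].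
Qed.

Lemma acyclic_free : ~ (exists p, graph_cycle (farey_graph alpha) p) ->
  free_number alpha.
Proof.
move=> nocyc.
have ker u : rep u = 1%g -> u = 1%g.
  have [b [s [-> ns]]] := syllP u; rewrite eval_syll => s1.
  by rewrite (acyclic_syll nocyc ns s1).
pose f := fun u : F => rep u.
have fM : {morph f : u v / (u * v)%g} by move=> u v; exact: eval_mul.
pose M := isMultiplicative.Build _ _ f fM.
pose f' : {multiplicative F -> SL2 R} := HB.pack f M.
exists f'; split=> [u _|u v _ _ euv|g /GgroupP[u ->]]; last by exists u.
  by apply/GgroupP; exists u.
apply/divg1_eq/ker; rewrite eval_mul evalV; have -> : rep u = rep v := euv.
exact: mulgV.
Qed.

End Acyclic.

(** * Free groups give acyclic graphs *)

Section Free.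
Hypothesis free : free_number alpha.

(** Freeness provides some isomorphism [f], not [rep] itself. Choosing preimages [k] of the
    generators under [f] gives [rep] as [f] after [eval k], where [eval k] is a surjective
    endomorphism and hence injective by the Hopf property. *)
Lemma free_rep_inj : injective (fun u : F => rep u).
Proof.
case: free => f [fG finj fsurj] u v /= euv; apply: divg1_eq.
have lift b : exists k, f k = pgen b.
  have /fsurj[k _ <-] : Ggroup alpha (pgen b); last by exists k.
  by apply/GgroupP; exists (gen b); rewrite eval_gen.
have /boolp.choice[k kP] := lift.
have fE w : f (eval k w) = eval pgen w.
  have f1 : f 1%g = 1%g.
    by apply: (@mulgI _ (f 1%g)); rewrite -gmulfM !mulg1.
  have fV x : f x^-1%g = (f x)^-1%g.
    by apply/esym/mulg1_eq; rewrite -gmulfM mulgV.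
  elim: w => //= a w IH; rewrite gmulfM IH /eval_letter; congr (_ * _)%g.
  by case: ifP => _; rewrite ?fV kP.
apply: (@free_group_hopfian _ k).
  move=> z; have /GgroupP[w fz] : Ggroup alpha (f z) by exact: fG.
  by exists w; apply: finj; rewrite ?in_setT // fE.
apply: finj; rewrite ?in_setT // fE eval_mul evalV euv mulgV.
by apply: (@mulgI _ (f 1%g)); rewrite -gmulfM !mulg1.
Qed.

(** Commutation pulls back along the injective [rep], so the conjugate of [gen c] by [u] is a power
    of [gen b]. Its exponent sum in [c] is 1, which forces [b = c] and exponent 1; then [u] commutes
    with [gen b]. *)
Lemma free_stabilizer u b c : moebius (rep u) (cusp c) = cusp b ->
  c = b /\ exists k, u = expgz (gen b) k.
Proof.
move=> ucb; have [|k uk] := @centralizer_gen _ b (u * gen c * u^-1)%g.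
  apply: free_rep_inj; rewrite !eval_mul evalV !eval_gen.
  exact: commute_conj_pgen.
have := congr1 (fun v : F => exponent_sum c v) uk.
rewrite !exponent_sumM exponent_sumV exponent_sum_expgz !exponent_sum_gen.
rewrite eqxx addrAC subrr add0r.
have [bc|_] := eqVneq b c; last by rewrite mul0r.
subst c; rewrite mul1r => k1; split=> //; apply: centralizer_gen.
move: uk; rewrite -k1 [expgz _ _]expg1 => /eqP; rewrite divg_eq => /eqP.
by move=> e; rewrite /commute e.
Qed.

(** A converse to [syll_walk]: passing to the next edge fixes the shared vertex, so it is a power of
    the generator there, nonzero because the walk does not turn back. Each step of [p] contributes
    one exponent. *)
Lemma free_walk u b (p : seq (option R)) :
  path adj (moebius (rep u) (cusp b)) p ->
  nonbacktracking [:: moebius (rep u) (cusp (~~ b)), moebius (rep u) (cusp b) & p] ->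
  exists (s : seq int) c, [/\ 0 \notin s, size s = size p &
    last (moebius (rep u) (cusp b)) p
      = moebius (rep (u * syll (@gen bool) b s)%g) (cusp c)].
Proof.
elim: p u b => [|y p IH] u b; first by exists [::], b; rewrite mulg1.
move=> /= /andP[/adjacentP[v [c [uv yv]]] pp] /andP[uy nb].
have [cb [k vk]] : c = b /\ exists k, (u^-1 * v)%g = expgz (gen b) k.
  by apply: free_stabilizer; rewrite eval_mul evalV moebiusM -uv moebiusK.
have {}vk : v = (u * expgz (gen b) k)%g by rewrite -vk mulVKg.
subst c y; have k0 : k != 0.
  by apply: contraNneq uy => k0; rewrite vk k0 [expgz _ _]expg0 mulg1.
have [|s [c [ns sz ls]]] := IH v (~~ b) pp; first by rewrite negbK -uv.
exists (k :: s), c; rewrite inE negb_or eq_sym k0 ns [size _]/= sz; split=> //.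
by rewrite [last _ _]/= ls vk -mulgA.
Qed.

(** Reading the cycle from the edge [x0 x1] onwards back to [x0] gives a nonempty alternating
    product starting with [~~ c] that takes a cusp to [cusp c]; by [free_stabilizer] it is a power
    of [gen c], which never starts with [~~ c]. *)
Lemma free_acyclic : ~ (exists p, graph_cycle (farey_graph alpha) p).
Proof.
case=> [[|x0 [|x1 [|x2 t]]] [//= _ /andP[cyc]]].
(* The closed walk repeats [x0], so distinctness is moved to the rotated list ending in [x0]; the
   turn at [x1] is covered by [x02]. *)
rewrite -[uniq _]/(uniq ([:: x0] ++ _)) uniq_catC cats1 => un.
have x02 : x0 != x2.
  move: un => /=; rewrite mem_rcons !inE => /and3P[_ + _].
  by rewrite negb_or eq_sym => /andP[].
move: cyc => /= /andP[/adjacentP[u [c [ex0 ex1]]] pp].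
have nb := uniq_nonbacktracking un.
have [||s [c' [ns sz ls]]] := @free_walk u (~~ c) (x2 :: rcons t x0).
- by rewrite -ex1.
- by rewrite negbK -ex0 -ex1; apply/andP; split; last exact: nb.
move: ls; rewrite /= last_rcons ex0 eval_mul moebiusM => /moebius_inj/esym.
move=> /free_stabilizer[_ [k sk]].
have : starts_with (~~ c) (syll (@gen bool) (~~ c) s).
  by rewrite starts_with_syll //; case: (s) sz.
rewrite sk; have [->//|k0] := eqVneq k 0.
rewrite -[expgz _ _]mulg1; apply/negP/starts_with_other.
exact: starts_with_expgzM.
Qed.

End Free.
End FareyGraph.

Theorem theorem4p13 (R : realType) (alpha : R) (alpha_gt0 : 0 < alpha) :
  relation_number alpha <-> ~ is_tree (farey_graph alpha).
Proof.
split=> [rel [_ acyc]|ntree free].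
  by apply: rel; apply: acyclic_free acyc; rewrite lt0r_neq0.
by apply: ntree; split; [exact: farey_connected|exact: free_acyclic].
Qed.
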